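(* For integers $r,n\ge 0$ let $f_r(n)$ denote the number of permutations in $S_n$ that avoid the generalized pattern $12\text{-}3$ and contain exactly $r$ occurrences of the generalized pattern $13\text{-}2$, and let $F_r(x)=\sum_{n\ge 0} f_r(n)x^n$. Then for every integer $r\ge 0$, $$F_r(x)=\frac{1-x}{1-2x}\,\delta_{r,0}+\frac{x^2}{1-2x}\sum_{d=1}^{r}\frac{F_{r-d}(x)-\sum_{j=0}^{d-1}f_{r-d}(j)x^j}{(1-x)^d}.$$
   Context: $S_n$ is the set of permutations $\pi=\pi_1\pi_2\cdots\pi_n$ of $\{1,\dots,n\}$; $S_0$ consists of the empty permutation only. An occurrence of a generalized pattern $ab\text{-}c$ (with $abc$ a permutation of $\{1,2,3\}$) in $\pi$ is a pair $(i,j)$ with $i+1<j\le n$ such that $(\pi_i,\pi_{i+1},\pi_j)$ is order-isomorphic to $(a,b,c)$ (so the first two letters are adjacent in $\pi$). $\pi$ avoids the pattern if it has no occurrence of it. $\delta_{r,0}$ is the Kronecker delta. The identity is one of formal power series. *)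

(* Defs.v *)
From HB Require Import structures.
From mathcomp Require Import all_boot all_order all_algebra all_fingroup.
From mathcomp Require Import boolp.

Set Implicit Arguments.
Unset Strict Implicit.
Unset Printing Implicit Defensive.

Import GRing.Theory.

(** * Generalized patterns of the form ab-c *)

Definition order_iso (s t : seq nat) : bool :=
  (size s == size t) &&
  [forall p : 'I_(size s), forall q : 'I_(size s),
     (nth 0 s p < nth 0 s q) == (nth 0 t p < nth 0 t q)].

(* One-line notation with letters in {1, ..., n}. *)
Definition word n (pi : 'S_n) : seq nat := [seq (pi i : nat).+1 | i <- enum 'I_n].

(* Positions are counted from 0; in an occurrence (i, j) the first two letters
   of the pattern sit at the adjacent positions i and i + 1, the last at j. *)
Definition occurrences n (a b c : nat) (pi : 'S_n) : {set 'I_n * 'I_n} :=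
  [set ij : 'I_n * 'I_n | (ij.1.+1 < ij.2) &&
     order_iso [:: nth 0 (word pi) ij.1; nth 0 (word pi) ij.1.+1;
                   nth 0 (word pi) ij.2] [:: a; b; c]].

Definition avoids n (a b c : nat) (pi : 'S_n) : bool :=
  occurrences a b c pi == set0.

Definition f (r n : nat) : nat :=
  #|[set pi : 'S_n | avoids 1 2 3 pi & #|occurrences 1 3 2 pi| == r]|.

(** * Formal power series in one variable *)

Local Open Scope ring_scope.

Record fps (R : Type) : Type := Fps { coefs : nat -> R }.

HB.instance Definition _ (R : Type) := gen_eqMixin (fps R).
HB.instance Definition _ (R : Type) := gen_choiceMixin (fps R).

Lemma fpsP (R : Type) (u v : fps R) : coefs u =1 coefs v -> u = v.
Proof. by case: u => u; case: v => v /= /funext ->. Qed.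

Section Zmodule.
Variable R : zmodType.
Implicit Types u v w : fps R.

Definition fps_zero : fps R := Fps (fun=> 0).
Definition fps_opp u := Fps (fun n => - coefs u n).
Definition fps_add u v := Fps (fun n => coefs u n + coefs v n).

Fact fps_addA : associative fps_add.
Proof. by move=> u v w; apply: fpsP => n /=; rewrite addrA. Qed.
Fact fps_addC : commutative fps_add.
Proof. by move=> u v; apply: fpsP => n /=; rewrite addrC. Qed.
Fact fps_add0 : left_id fps_zero fps_add.
Proof. by move=> u; apply: fpsP => n /=; rewrite add0r. Qed.
Fact fps_addN : left_inverse fps_zero fps_opp fps_add.
Proof. by move=> u; apply: fpsP => n /=; rewrite addNr. Qed.

HB.instance Definition _ :=
  GRing.isZmodule.Build (fps R) fps_addA fps_addC fps_add0 fps_addN.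

End Zmodule.

Section ComRing.
Variable R : comNzRingType.
Implicit Types u v w : fps R.

Definition fps_const (a : R) : fps R := Fps (fun n => if n is 0 then a else 0).
Definition fps_one : fps R := fps_const 1.
Definition fps_mul u v : fps R :=
  Fps (fun n => \sum_(i < n.+1) coefs u i * coefs v (n - i)).

(* The ring laws are inherited from polynomials by truncation. *)
Definition fps_trunc n u : {poly R} := \poly_(i < n) coefs u i.

Lemma coef_trunc n u i : (i < n)%N -> (fps_trunc n u)`_i = coefs u i.
Proof. by move=> lin; rewrite coef_poly lin. Qed.

Lemma coef_trunc_mul n u v i : (i < n)%N ->
  coefs (fps_mul u v) i = (fps_trunc n u * fps_trunc n v)`_i.
Proof.
move=> lin; rewrite coefM /=; apply: eq_bigr => j _.
rewrite !coef_trunc //; first exact: leq_ltn_trans (leq_subr _ _) lin.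
by apply: leq_ltn_trans lin; rewrite -ltnS.
Qed.

Fact fps_mulA : associative fps_mul.
Proof.
move=> u v w; apply: fpsP => n.
transitivity ((fps_trunc n.+1 u * (fps_trunc n.+1 v * fps_trunc n.+1 w))`_n).
  rewrite coefM; apply: eq_bigr => j _.
  by rewrite coef_trunc // -coef_trunc_mul // ltnS leq_subr.
rewrite mulrA coefM; apply: eq_bigr => j _.
by rewrite -coef_trunc_mul // coef_trunc // ltnS leq_subr.
Qed.

Fact fps_mulC : commutative fps_mul.
Proof.
move=> u v; apply: fpsP => n.
by rewrite !(@coef_trunc_mul n.+1) // mulrC.
Qed.

Fact fps_mul1 : left_id fps_one fps_mul.
Proof.
move=> u; apply: fpsP => n /=.
rewrite big_ord_recl /= mul1r subn0 big1 ?addr0 // => i _.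
by rewrite mul0r.
Qed.

Fact fps_mulDl : left_distributive fps_mul (@fps_add R).
Proof.
move=> u v w; apply: fpsP => n /=.
by rewrite -big_split; apply: eq_bigr => i _; rewrite mulrDl.
Qed.

Fact fps_one_neq0 : fps_one != 0.
Proof.
apply/eqP => /(congr1 (fun u => coefs u 0)) /= /eqP.
by rewrite oner_eq0.
Qed.

HB.instance Definition _ := GRing.Zmodule_isComNzRing.Build (fps R)
  fps_mulA fps_mulC fps_mul1 fps_mulDl fps_one_neq0.

Definition fps_var : fps R := Fps (fun n => (n == 1)%:R).

End ComRing.

Section ComUnitRing.
Variable R : comUnitRingType.
Implicit Types u v w : fps R.

Definition fps_unit : pred (fps R) := fun u => coefs u 0 \is a GRing.unit.

(* The first n coefficients of the inverse, from the recurrence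
   u_0 v_n = [n = 0] - \sum_(i < n) u_(n - i) v_i. *)
Fixpoint fps_inv_seq u n : seq R :=
  if n is m.+1 then
    let s := fps_inv_seq u m in
    rcons s ((coefs u 0)^-1 *
             ((m == 0)%:R - \sum_(i < m) s`_i * coefs u (m - i)))
  else [::].

Definition fps_inv u : fps R :=
  if fps_unit u then Fps (fun n => (fps_inv_seq u n.+1)`_n) else u.

Lemma size_fps_inv_seq u n : size (fps_inv_seq u n) = n.
Proof. by elim: n => //= n IHn; rewrite size_rcons IHn. Qed.

Lemma nth_fps_inv_seq u n i : (i < n)%N ->
  (fps_inv_seq u n)`_i = (fps_inv_seq u i.+1)`_i.
Proof.
elim: n => // n IHn; rewrite ltnS leq_eqVlt => /predU1P[-> //|lin].
by rewrite [fps_inv_seq u n.+1]/= nth_rcons size_fps_inv_seq lin IHn.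
Qed.

Fact fps_mulVr : {in fps_unit, left_inverse 1 fps_inv *%R}.
Proof.
move=> u Uu; apply: fpsP => n; rewrite /fps_inv ifT //.
transitivity (\sum_(i < n.+1) (fps_inv_seq u n.+1)`_i * coefs u (n - i)).
  by apply: eq_bigr => i _; rewrite (@nth_fps_inv_seq u n.+1).
rewrite big_ord_recr /= subnn nth_rcons size_fps_inv_seq ltnn eqxx.
under eq_bigr => i _ do rewrite nth_rcons size_fps_inv_seq ltn_ord.
by rewrite mulrAC mulVr // mul1r addrC subrK; case: n.
Qed.

Fact fps_unitP u v : v * u = 1 -> fps_unit u.
Proof.
move=> /(congr1 (fun w => coefs w 0)) /=.
rewrite big_ord_recl big_ord0 addr0 /= => vu1.
by apply/unitrPr; exists (coefs v 0); rewrite mulrC.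
Qed.

Fact fps_inv_out : {in [predC fps_unit], fps_inv =1 id}.
Proof. by move=> u; rewrite inE => Uu; rewrite /fps_inv ifN. Qed.

HB.instance Definition _ := GRing.ComNzRing_hasMulInverse.Build (fps R)
  fps_mulVr fps_unitP fps_inv_out.

Lemma unit_fpsE u : (u \is a GRing.unit) = (coefs u 0 \is a GRing.unit).
Proof. by []. Qed.

End ComUnitRing.

(* Integer coefficients suffice: 1 - x and 1 - 2x are units of Z[[x]]. *)
Definition x : fps int := fps_var int.

Lemma unit_1subx : 1 - x \is a GRing.unit.
Proof. by []. Qed.

Lemma unit_1sub2x : 1 - 2 * x \is a GRing.unit.
Proof. by rewrite unit_fpsE /= big_ord_recl big_ord0. Qed.

Definition F (r : nat) : fps int := Fps (fun n => (f r n)%:R).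

(* Main.v *)
(* Let g_k(n) count the permutations of size n that avoid 12-3, have exactly r
   occurrences of 13-2, and in which at least k letters exceed the first one.
   Delete the first letter a of such a permutation of size n + 1 in which exactly
   k letters exceed a. If a is followed by a descent, no occurrence is lost, and
   what remains is counted by g_k(n). If it is followed by an ascent to b,
   avoiding 12-3 forces b to be the largest letter; a then starts k - 1
   occurrences of 13-2, b starts none, and deleting both leaves an arbitrary
   avoider of size n - 1 with k - 1 fewer occurrences of 13-2. For the generating
   functions G_k of g_k this reads
     (1 - x) G_0 = G_1 + [r = 0],
     (1 - x) G_(d+1) = G_(d+2) + x^2 (F_(r-d) - sum_(j<d) f_(r-d)(j) x^j)
   for d <= r, and G_(r+2) = 0. Unfolding the second family gives G_1, and the
   first equation with G_0 = F_r then gives the identity, since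
   (1 - x)^2 - x^2 = 1 - 2x. *)

Require Import Defs.
From mathcomp Require Import all_boot all_order all_algebra.
From mathcomp Require Import all_fingroup zify ring.

Set Implicit Arguments.
Unset Strict Implicit.
Unset Printing Implicit Defensive.

Import GRing.Theory.

(** * Pattern occurrences in words *)

(** Occurrences are grouped by their first letter, so deleting the head of a word drops one summand.
    The default of [head] is harmless: if [v] is empty, so is [behead v]. *)
Fixpoint occ (P : nat -> nat -> nat -> bool) (w : seq nat) : nat :=
  if w is a :: v then count (P a (head 0 v)) (behead v) + occ P v else 0.

Lemma occE P w : \sum_(0 <= i < size w) \sum_(0 <= j < size w)
    ((i.+1 < j) && P (nth 0 w i) (nth 0 w i.+1) (nth 0 w j) : nat) = occ P w.
Proof.
elim: w => [|a v IHv] /=; first by rewrite big_geq.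
rewrite big_nat_recl // -IHv; congr (_ + _).
  rewrite big_nat_recl //= add0n nth0.
  case: v {IHv} => [|b t] /=; first by rewrite big_geq.
  rewrite big_nat_recl //= add0n -sum1_count [RHS](big_nth 0) [RHS]big_mkcond.
  by apply: eq_bigr => i _; case: (P _ _ _).
apply: eq_big_nat => i _.
by rewrite big_nat_recl //= add0n; apply: eq_bigr.
Qed.

Lemma occ_map P g w : (forall a b c, P (g a) (g b) (g c) = P a b c) ->
  occ P (map g w) = occ P w.
Proof.
move=> gP; elim: w => //= a v ->; congr (_ + _).
by case: v => //= b t; rewrite count_map; apply: eq_count => c /=.
Qed.

Lemma order_iso123 a b c : order_iso [:: a; b; c] [:: 1; 2; 3] = (a < b < c).
Proof.
rewrite /order_iso /=; apply/forallP/andP => [iso|[ab bc] p].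
  split.
    by have /forallP/(_ (@Ordinal 3 1 isT))/eqP := iso (@Ordinal 3 0 isT).
  by have /forallP/(_ (@Ordinal 3 2 isT))/eqP := iso (@Ordinal 3 1 isT).
apply/forallP => q; case: p => [[|[|[|p]]] //= _]; case: q => [[|[|[|q]]] //= _];
  apply/eqP; lia.
Qed.

Lemma order_iso132 a b c : order_iso [:: a; b; c] [:: 1; 3; 2] = (a < c < b).
Proof.
rewrite /order_iso /=; apply/forallP/andP => [iso|[ac cb] p].
  split.
    by have /forallP/(_ (@Ordinal 3 2 isT))/eqP := iso (@Ordinal 3 0 isT).
  by have /forallP/(_ (@Ordinal 3 1 isT))/eqP := iso (@Ordinal 3 2 isT).
apply/forallP => q; case: p => [[|[|[|p]]] //= _]; case: q => [[|[|[|q]]] //= _];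
  apply/eqP; lia.
Qed.

Definition occ123 := occ (fun a b c => a < b < c).
Definition occ132 := occ (fun a b c => a < c < b).

(** * Words of permutations *)

Lemma size_word n (s : 'S_n) : size (word s) = n.
Proof. by rewrite size_map size_enum_ord. Qed.

Lemma card_occurrences n a b c (s : 'S_n) :
  #|occurrences a b c s| =
  occ (fun y z t => order_iso [:: y; z; t] [:: a; b; c]) (word s).
Proof.
rewrite -occE size_word big_mkord -sum1_card.
under [RHS]eq_bigr => i _ do rewrite big_mkord.
rewrite pair_big big_mkcond /=; apply: eq_bigr => -[i j] _ /=.
by rewrite inE /=; case: (_ && _).
Qed.

Lemma eq_occ P Q w : (forall a b c, P a b c = Q a b c) -> occ P w = occ Q w.
Proof.
by move=> PQ; elim: w => //= a v ->; congr (_ + _); apply: eq_count => c.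
Qed.

Definition good (r : nat) w := (occ123 w == 0) && (occ132 w == r).

Lemma fE r n : f r n = \sum_(s : 'S_n) good r (word s).
Proof.
rewrite /f -sum1_card big_mkcond; apply: eq_bigr => s _ /=.
rewrite inE /avoids -cards_eq0 !card_occurrences /good.
rewrite (eq_occ _ order_iso123) (eq_occ _ order_iso132).
by rewrite -/occ123 -/occ132; case: (_ && _).
Qed.

(** [bump a.+1] raises the letters from [a.+1] on by one, which makes room for the new first
    letter. *)
Lemma word_lift_perm n a (s : 'S_n) :
  word (lift_perm ord0 a s) = a.+1 :: map (bump a.+1) (word s).
Proof.
rewrite /word enum_ordSl /= lift_perm_id; congr (_ :: _).
rewrite -!map_comp; apply: eq_map => i /=.
by rewrite lift_perm_lift /= bumpS.
Qed.

(** Prepending a letter is injective on pairs [(a, s)], and both sides have (n+1)! elements. *)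
Lemma sum_perm_recl n (E : 'S_n.+1 -> nat) :
  \sum_s E s = \sum_(a < n.+1) \sum_(s : 'S_n) E (lift_perm ord0 a s).
Proof.
have inj_lift : injective (fun u : 'I_n.+1 * 'S_n => lift_perm ord0 u.1 u.2).
  move=> [a s] [b t] /= eq_ab; have /= ab : a = b.
    by rewrite -(lift_perm_id ord0 a s) eq_ab lift_perm_id.
  rewrite -ab in eq_ab *; congr (_, _); apply/permP => i.
  by apply: (@lift_inj _ a); rewrite -!(lift_perm_lift ord0) eq_ab.
rewrite pair_bigA (reindex _ (onW_bij _ (inj_card_bij inj_lift _))) //=.
by rewrite card_prod card_ord !card_Sn factS.
Qed.

Lemma perm_word n (s : 'S_n) : perm_eq (word s) (iota 1 n).
Proof.
apply: uniq_perm; rewrite ?iota_uniq //.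
  by rewrite map_inj_uniq ?enum_uniq // => i j [] /ord_inj/perm_inj.
move=> m; rewrite mem_iota; apply/mapP/idP => [[i _ ->]|].
  by rewrite /= add1n ltnS ltn_ord.
case: m => //= m; rewrite add1n ltnS => mn.
by exists (s^-1%g (Ordinal mn)); rewrite ?mem_enum // permKV.
Qed.

Lemma count_geq_word n b (s : 'S_n) : 0 < b ->
  count (fun z => b <= z) (word s) = n.+1 - b.
Proof.
move=> b0; rewrite (seq.permP (perm_word s)); elim: n {s} => [|n IHn].
  by move: b0 => /=; lia.
by rewrite -[X in iota _ X]addn1 iotaD count_cat IHn /=; lia.
Qed.

Lemma mem_word n (s : 'S_n) m : (m \in word s) = (0 < m <= n).
Proof. by rewrite (perm_mem (perm_word s)) mem_iota add1n ltnS. Qed.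

(** The boolean lower bound, read as a number, also covers the empty word, where [head] gives 0. *)
Lemma head_word n (s : 'S_n) : (0 < n) <= head 0 (word s) <= n.
Proof.
have := size_word s; case Ew: (word s) => [|c w] /= sz; first by rewrite -sz.
by have := mem_word s c; rewrite Ew mem_head; lia.
Qed.

(** * Effect of prepending a letter on occurrences *)

Lemma occ123_bump a w : occ123 (map (bump a) w) = occ123 w.
Proof. by apply: occ_map => b c d; rewrite /bump; lia. Qed.

Lemma occ132_bump a w : occ132 (map (bump a) w) = occ132 w.
Proof. by apply: occ_map => b c d; rewrite /bump; lia. Qed.

Lemma occ_cons_descent (P : nat -> nat -> nat -> bool) a v :
  (forall b c, P a b c -> a < b) ->
  head 0 v <= a -> occ P (a :: v) = occ P v.
Proof.
move=> Pab va /=; rewrite (eq_count (a2 := pred0)) ?count_pred0 // => c /=.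
by apply/negP => /Pab; lia.
Qed.

Lemma good_bump_descent r a w : head 0 w < a ->
  good r (a :: map (bump a) w) = good r w.
Proof.
move=> wa; rewrite /good.
have ha : head 0 (map (bump a) w) <= a.
  by case: w wa => //= b _; rewrite /bump; lia.
rewrite /occ123 /occ132 !occ_cons_descent //; try by move=> b c /andP[]; lia.
by rewrite -/occ123 -/occ132 occ123_bump occ132_bump.
Qed.

Lemma good_bump_ascent r n a (b : 'I_n.+1) (s : 'S_n) : 0 < a <= b.+1 ->
  good r (a :: map (bump a) (word (lift_perm ord0 b s))) =
  (b == ord_max) && (occ123 (word s) == 0) &&
    (n.+1 - a + occ132 (word s) == r).
Proof.
move=> /andP[a0 ab]; rewrite word_lift_perm /good.
have bE : bump a b.+1 = b.+2 by rewrite /bump ab.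
have -> : occ123 (a :: map (bump a) (b.+1 :: map (bump b.+1) (word s))) =
    n - b + occ123 (b.+1 :: map (bump b.+1) (word s)).
  rewrite -[in RHS](occ123_bump a) /occ123 /= bE; congr (_ + _).
  rewrite -[RHS]/(n.+1 - b.+1) -(count_geq_word s) // !count_map.
  by apply: eq_count => c; rewrite /= /bump; lia.
have [->|nb] := eqVneq b ord_max; last first.
  have bn : b < n by move: nb (ltn_ord b); rewrite -val_eqE /=; lia.
  by rewrite /=; lia.
rewrite subnn add0n /=.
have -> : map (bump n.+1) (word s) = word s.
  by apply: map_id_in => c; rewrite mem_word /bump; lia.
have h : head 0 (word s) <= n.+1 by have := head_word s; lia.
rewrite /occ123 occ_cons_descent //; last by move=> b' c; lia.
congr (_ && (_ == r)).
rewrite /occ132 -[in RHS](@occ_cons_descent (fun b c d => b < d < c) n.+1) //;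
  last by move=> b' c; lia.
rewrite -/occ132 -[in RHS](occ132_bump a) /occ132 /=.
rewrite {1}/bump (leq_trans ab (ltn_ord b)) add1n; congr (_ + _).
rewrite -(count_geq_word s) // count_map.
apply: eq_in_count => c; rewrite mem_word /= /bump; lia.
Qed.

(* The condition says that at least k letters exceed the first one. On the empty
   word [head] returns 0, so that gap_count r 0 0 = f r 0. *)
Definition gap_count r n k :=
  \sum_(s : 'S_n) (good r (word s) && (k + head 0 (word s) <= n)).

Lemma gap_count_ge r n k : 0 < k -> n <= k -> gap_count r n k = 0.
Proof.
move=> k0 nk; rewrite /gap_count big1 // => s _; apply/eqP; rewrite eqb0.
by have := head_word s; lia.
Qed.

Lemma gap_count0 r n : gap_count r n 0 = f r n.
Proof.
rewrite fE; apply: eq_bigr => s _; congr (nat_of_bool _).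
by have := head_word s; lia.
Qed.

Lemma f0 r : f r 0 = (r == 0).
Proof.
rewrite fE (eq_bigr (fun=> (r == 0) : nat)) => [|s _].
  by rewrite sum_nat_const card_Sn mul1n.
by rewrite (size0nil (size_word s)) /good /= eq_sym.
Qed.

Lemma sum_good_ascent r n k : 0 < k <= n ->
  \sum_(s : 'S_n) (good r (n.+1 - k :: map (bump (n.+1 - k)) (word s)) &&
                    (n.+1 - k <= head 0 (word s))) =
  if k <= r.+1 then f (r.+1 - k) n.-1 else 0.
Proof.
case: n => [|n] kn; first by lia.
rewrite sum_perm_recl exchange_big /=.
transitivity (\sum_(s : 'S_n)
    ((occ123 (word s) == 0) && (k.-1 + occ132 (word s) == r))).
  apply: eq_bigr => s _.
  rewrite (bigD1 ord_max) //= big1 ?addn0 => [|b nb].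
    rewrite good_bump_ascent ?word_lift_perm; last by rewrite /=; lia.
    rewrite eqxx /=; congr (nat_of_bool _).
    have -> : n.+1 - (n.+2 - k) = k.-1 by lia.
    by rewrite andbC; have -> : n.+2 - k <= n.+1 by lia.
  apply/eqP; rewrite eqb0; apply/negP => /andP[]; rewrite {2}word_lift_perm /=.
  move=> + ab; rewrite good_bump_ascent; last by lia.
  by rewrite (negPf nb).
case: ifP => kr; last first.
  by rewrite big1 // => s _; apply/eqP; rewrite eqb0; lia.
rewrite fE; apply: eq_bigr => s _; congr (nat_of_bool _).
by rewrite /good; congr (_ && _); lia.
Qed.

Lemma gap_count_recl r n k :
  gap_count r n.+1 k = gap_count r n.+1 k.+1 + gap_count r n k +
  if (0 < k <= n) && (k <= r.+1) then f (r.+1 - k) n.-1 else 0.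
Proof.
have [nk|kn] : n < k \/ k <= n by lia.
  by rewrite ifF ?gap_count_ge //; lia.
have -> : (if (0 < k <= n) && (k <= r.+1) then f (r.+1 - k) n.-1 else 0) =
  \sum_(s : 'S_n) (good r (n.+1 - k :: map (bump (n.+1 - k)) (word s)) &&
                    (n.+1 - k <= head 0 (word s))).
  rewrite kn andbT; case: (posnP k) => [->|k0] /=; last first.
    by rewrite sum_good_ascent // k0.
  rewrite big1 // => s _; apply/eqP; rewrite eqb0.
  by have := head_word s; lia.
transitivity (gap_count r n.+1 k.+1 +
    \sum_(s : 'S_n.+1) (good r (word s) && (head 0 (word s) == n.+1 - k))).
  rewrite /gap_count -big_split; apply: eq_bigr => s _ /=.
  by case: (good _ _) => //=; have := head_word s; lia.
rewrite -addnA; congr (_ + _).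
rewrite sum_perm_recl (bigD1 (inord (n - k))) //=.
rewrite [X in _ + X]big1 ?addn0; last first.
  move=> a; rewrite -val_eqE /= inordK; last by lia.
  move=> ak; apply: big1 => s _; apply/eqP; rewrite eqb0 word_lift_perm /=.
  by move: ak; lia.
rewrite /gap_count -big_split; apply: eq_bigr => s _ /=.
rewrite word_lift_perm inordK; last by lia.
have -> : (n - k).+1 = n.+1 - k by lia.
rewrite /= eqxx andbT; have [hk|hk] := leqP (n.+1 - k) (head 0 (word s)).
  by rewrite andbT (_ : (k + head 0 (word s) <= n) = false) ?andbF //; lia.
rewrite good_bump_descent // andbF addn0.
by rewrite (_ : k + head 0 (word s) <= n) ?andbT //; lia.
Qed.

Local Open Scope ring_scope.

Lemma coef_add (u v : fps int) n : coefs (u + v) n = coefs u n + coefs v n.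
Proof. by []. Qed.

Lemma coef_sum I (s : seq I) (u : I -> fps int) n :
  coefs (\sum_(i <- s) u i) n = \sum_(i <- s) coefs (u i) n.
Proof. exact: (big_morph (fun v => coefs v n)). Qed.

Lemma coef_xM (u : fps int) n :
  coefs (x * u) n = if n is m.+1 then coefs u m else 0.
Proof.
case: n => [|n] /=; first by rewrite big_ord_recl big_ord0 mul0r addr0.
rewrite 2!big_ord_recl /= mul0r add0r mul1r big1 ?addr0 ?subSS ?subn0 // => i _.
by rewrite mul0r.
Qed.

Lemma coef_natM (u : fps int) m n : coefs (m%:R * u) n = m%:R * coefs u n.
Proof.
elim: m => [|m IHm]; first by rewrite !mul0r.
by rewrite !mulrS !mulrDl !mul1r coef_add IHm.
Qed.

Lemma coef_xX j n : coefs (x ^+ j) n = (n == j)%:R.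
Proof.
elim: j n => [|j IHj] n; first by rewrite expr0; case: n.
by rewrite exprS coef_xM; case: n => // n; rewrite IHj.
Qed.

Definition tailF r d : fps int :=
  F (r - d) - \sum_(0 <= j < d) (f (r - d) j)%:R * x ^+ j.

Lemma coef_tailF r d n :
  coefs (tailF r d) n = if (d <= n)%N then (f (r - d) n)%:R else 0.
Proof.
rewrite /tailF coef_add /= coef_sum.
under eq_bigr => j _ do rewrite coef_natM coef_xX.
have [dn|nd] := leqP d n.
  rewrite big_nat big1 ?subr0 // => j jd.
  by rewrite gtn_eqF ?mulr0 //; lia.
rewrite (big_cat_nat (n := n)) //= ?(ltnW nd) //.
rewrite big_nat big1 ?add0r => [|j jn]; last by rewrite gtn_eqF ?mulr0 //; lia.
rewrite big_ltn // eqxx mulr1 big_nat big1 ?addr0 ?subrr // => j jn.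
by rewrite ltn_eqF ?mulr0 //; lia.
Qed.

Definition gapF r k : fps int := Fps (fun n => (gap_count r n k)%:R).

Lemma gapF0 r : gapF r 0 = F r.
Proof. by apply: fpsP => n /=; rewrite gap_count0. Qed.

Lemma gapF_recl0 r : gapF r 0 = gapF r 1 + x * gapF r 0 + (r == 0%N)%:R.
Proof.
apply: fpsP => n; rewrite !coef_add coef_xM.
have -> : (r == 0%N)%:R = (r == 0%N)%:R * 1 :> fps int by rewrite mulr1.
rewrite coef_natM; case: n => [|n] /=.
  by rewrite (@gap_count_ge r 0 1) // gap_count0 mulr0n !add0r mulr1 f0.
by rewrite gap_count_recl /= addn0 mulr0 addr0 natrD.
Qed.

Lemma gapF_recl r d : gapF r d.+1 = gapF r d.+2 + x * gapF r d.+1 +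
  (if (d <= r)%N then x ^+ 2 * tailF r d else 0).
Proof.
apply: fpsP => n; rewrite !coef_add coef_xM.
have -> : coefs (if (d <= r)%N then x ^+ 2 * tailF r d else 0) n =
   if (d <= r)%N then
     (if n is m.+2 then (if (d <= m)%N then (f (r - d) m)%:R else 0) else 0)
   else 0.
  case: ifP => // dr; rewrite expr2 -mulrA coef_xM; case: n => // n.
  by rewrite coef_xM; case: n => // n; rewrite coef_tailF.
case: n => [|n] /=.
  by rewrite !gap_count_ge //; case: ifP; rewrite !addr0.
rewrite gap_count_recl !natrD; congr (_ + _).
case: n => [|n] /=; first by case: ifP.
by rewrite !ltnS subSS; case: (d <= n)%N; case: (d <= r)%N.
Qed.

Lemma gapF_eq0 r k : (r.+2 <= k)%N -> gapF r k = 0.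
Proof.
move=> rk; apply: fpsP => n /=; elim: n k rk => [|n IHn] k rk.
  by rewrite gap_count_ge //; lia.
have [m] := ubnP (n.+1 - k); elim: m k rk => // m IHm k rk nkm.
have [nk|kn] := leqP n.+1 k; first by rewrite gap_count_ge //; lia.
rewrite gap_count_recl natrD natrD IHn // IHm; [|lia..].
by rewrite ifF //; lia.
Qed.

Lemma gapF1E r :
  (1 - x) * gapF r 1 = x ^+ 2 * \sum_(0 <= d < r.+1) tailF r d / (1 - x) ^+ d.
Proof.
have ux := unit_1subx.
suff GE m : (m <= r.+1)%N -> (1 - x) * gapF r 1 =
    x ^+ 2 * (\sum_(0 <= d < m) tailF r d / (1 - x) ^+ d) +
    (1 - x) * gapF r m.+1 / (1 - x) ^+ m.
  by rewrite (GE r.+1) // gapF_eq0 // mulr0 mul0r addr0.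
elim: m => [|m IHm] mr; first by rewrite big_geq // mulr0 add0r expr0 divr1.
rewrite IHm ?(ltnW mr) // big_nat_recr //= mulrDr -addrA; congr (_ + _).
have -> : (1 - x) * gapF r m.+1 = x ^+ 2 * tailF r m + gapF r m.+2.
  by have := gapF_recl r m; rewrite -ltnS mr mulrBl mul1r => {1}->; ring.
rewrite mulrDl mulrA; congr (_ + _).
apply: (mulIr (unitrX m.+1 ux)); rewrite mulrVK ?unitrX //.
by rewrite exprSr mulrA mulrVK ?unitrX // mulrC.
Qed.

Theorem theorem2p6 (r : nat) :
  F r = (1 - x) / (1 - 2 * x) * (r == 0%N)%:R
      + x ^+ 2 / (1 - 2 * x) *
        \sum_(1 <= d < r.+1)
          (F (r - d) - \sum_(0 <= j < d) (f (r - d) j)%:R * x ^+ j)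
          / (1 - x) ^+ d.
Proof.
set S := \sum_(1 <= d < r.+1) _.
have gapF1S : (1 - x) * gapF r 1 = x ^+ 2 * F r + x ^+ 2 * S.
  have T0 : tailF r 0 = F r by rewrite /tailF subn0 [X in _ - X]big_geq // subr0.
  by rewrite gapF1E big_ltn // mulrDr T0 expr0 divr1.
have F_gapF1 : (1 - x) * F r = gapF r 1 + (r == 0%N)%:R.
  by have := gapF_recl0 r; rewrite gapF0 mulrBl mul1r => {1}->; ring.
rewrite mulrAC [_ / _ * S]mulrAC -mulrDl.
apply: (mulIr unit_1sub2x); rewrite mulrVK ?unit_1sub2x //.
transitivity ((1 - x) * ((1 - x) * F r) - x ^+ 2 * F r); first by ring.
by rewrite F_gapF1 mulrDr gapF1S; ring.
Qed.
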